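(* Assume that the branch of stationary points $$y(E)=(\lambda(E),\mu(E),w(E)^\top,x(E)^\top)^\top$$ extends down to $E\downarrow0$, i.e. is defined on $(0,E_{\mathrm{uw}}]$, and that there is a constant $s_0>0$ such that $A^\top W(E)A\succeq s_0^2I_n$ for all sufficiently small $E>0$, where $W(E)=\mathrm{diag}(w(E))$. Define $$S:=\{\,i\in\{1,\dots,m\}:\ \liminf_{E\to0^+}w_i(E)>0\,\},\qquad s:=|S|,$$ and $r(E)=Ax(E)-b$. The following statements hold true: (a) $S=\mathcal I(E)$ for all sufficiently small $E>0$, where $\mathcal I(E):=\{\,i\in\{1,\dots,m\}: w_i(E)\ge s_0^2/\|A\|^2\,\}$; hence $s\ge n$. (b) $i\in S\iff\lim_{E\to0^+}r_i(E)=0$. (c) $\lim_{E\to0^+}w_i(E)=0$ for all $i\notin S$. (d) $\lim_{E\to0^+}w_i(E)=\frac1s$ for all $i\in S$. (e) $x(E)$ converges as $E\downarrow0$ to the unique vector $x^\ast\in\mathbb{R}^n$ satisfying the interpolation conditions on $S$, i.e. $A_Sx^\ast=b_S$, where $A_S$ is the submatrix of $A$ formed by the rows indexed by $S$ and $b_S$ is the corresponding subvector of $b$; consequently, for every $j=1,\dots,m$, $\lim_{E\downarrow0}r_j(E)=r_j^\ast:=a_j^\top x^\ast-b_j$. In particular $r_i^\ast=0$ for $i\in S$ and $r_j^\ast\ne0$ for $j\notin S$.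
   Context: Let $m\ge n$, $A\in\mathbb{R}^{m\times n}$ of full column rank with rows $a_i^\top$, $b\in\mathbb{R}^m$, $u=(1,\dots,1)^\top\in\mathbb{R}^m$, $x_{\mathrm{LS}}=(A^\top A)^{-1}A^\top b$ the ordinary least squares solution, $r_{\mathrm{LS}}=Ax_{\mathrm{LS}}-b$, $E_{\mathrm{uw}}=\frac1m\|r_{\mathrm{LS}}\|_2^2$; it is assumed that $|r_{\mathrm{LS}}|$ is not a constant vector. Norms are Euclidean/spectral; $Q\succeq s_0^2I_n$ means $z^\top Qz\ge s_0^2\|z\|^2$ for all $z$. $W=\mathrm{diag}(w)$; logarithm and squares of vectors are componentwise. For $y=(\lambda,\mu,w^\top,x^\top)^\top$ with $w\in(0,\infty)^m$, let $F(y;E)=(F_1,F_2,F_3^\top,F_4^\top)^\top$ with $$F_1=u^\top w-1,\quad F_2=w^\top(Ax-b)^2-E,\quad F_3=\log w+(1+\lambda)u+\mu(Ax-b)^2,\quad F_4=A^\top WAx-A^\top Wb,$$ and let $J(y)=\nabla_yF$ be its Jacobian with respect to $y$. The branch of stationary points (for the problem of maximizing the entropy $-\sum_iw_i\log w_i$ subject to $\sum_iw_i=1$ and $\sum_iw_i(a_i^\top x-b_i)^2=E$) is the smooth curve $y(E)$ with $F(y(E);E)=0$ obtained as the solution, on its maximal interval of existence $(E_{\min},E_{\mathrm{uw}}]$, $E_{\min}\ge0$, of $$y'(E)=J(y(E))^{-1}e_2,\qquad y(E_{\mathrm{uw}})=\bigl(-(1+\log\tfrac1m),\,0,\,\tfrac1mu^\top,\,x_{\mathrm{LS}}^\top\bigr)^\top,$$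 where $e_2$ is the second standard basis vector of $\mathbb{R}^{2+m+n}$. The branch extending to $E\downarrow0$ means $E_{\min}=0$. *)

(* Defs.v *)
From mathcomp Require Import all_boot all_order all_algebra.
From mathcomp Require Import all_classical all_reals all_analysis.

Set Implicit Arguments.
Unset Strict Implicit.
Unset Printing Implicit Defensive.

Import Order.TTheory GRing.Theory Num.Theory.
Import numFieldNormedType.Exports.

Local Open Scope classical_set_scope.
Local Open Scope ring_scope.

(* The library norm on matrices is the max norm, hence the explicit Euclidean
   and spectral norms; the topology on matrices is the same. *)
Definition norm2 (R : realType) (k : nat) (v : 'cV[R]_k) : R :=
  Num.sqrt (\sum_(i < k) v i 0 ^+ 2).

Definition specnorm (R : realType) (m n : nat) (A : 'M[R]_(m, n)) : R :=
  sup [set norm2 (A *m z) | z in [set z : 'cV[R]_n | norm2 z <= 1]].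

Definition psd_ge (R : realType) (n : nat) (Q : 'M[R]_n) (c : R) : Prop :=
  forall z : 'cV[R]_n, c * norm2 z ^+ 2 <= (z^T *m Q *m z) 0 0.

Definition x_LS (R : realType) (m n : nat) (A : 'M[R]_(m, n)) (b : 'cV[R]_m) :
  'cV[R]_n := invmx (A^T *m A) *m A^T *m b.

Definition r_LS (R : realType) (m n : nat) (A : 'M[R]_(m, n)) (b : 'cV[R]_m) :
  'cV[R]_m := A *m x_LS A b - b.

Definition E_uw (R : realType) (m n : nat) (A : 'M[R]_(m, n)) (b : 'cV[R]_m) :
  R := m%:R^-1 * norm2 (r_LS A b) ^+ 2.

(* Points y = (lambda, mu, w^T, x^T) and values of F are row vectors, because
   the library's jacobian acts on row vectors from the right; w and x
   themselves are column vectors. *)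
Notation dimY m n := (1 + (1 + (m + n)))%N.

Definition mkY (R : realType) (m n : nat)
    (lam mu : R) (w : 'cV[R]_m) (x : 'cV[R]_n) : 'rV[R]_(dimY m n) :=
  row_mx lam%:M (row_mx mu%:M (row_mx w^T x^T)).

Definition lamY (R : realType) (m n : nat) (y : 'rV[R]_(dimY m n)) : R :=
  lsubmx y 0 0.
Definition muY (R : realType) (m n : nat) (y : 'rV[R]_(dimY m n)) : R :=
  lsubmx (rsubmx y) 0 0.
Definition wY (R : realType) (m n : nat) (y : 'rV[R]_(dimY m n)) : 'cV[R]_m :=
  (lsubmx (rsubmx (rsubmx y)))^T.
Definition xY (R : realType) (m n : nat) (y : 'rV[R]_(dimY m n)) : 'cV[R]_n :=
  (rsubmx (rsubmx (rsubmx y)))^T.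

Definition Fmap (R : realType) (m n : nat) (A : 'M[R]_(m, n)) (b : 'cV[R]_m)
    (E : R) (y : 'rV[R]_(dimY m n)) : 'rV[R]_(dimY m n) :=
  let u : 'cV[R]_m := const_mx 1 in
  let w := wY y in
  let x := xY y in
  let r2 := map_mx (fun t : R => t ^+ 2) (A *m x - b) in
  let W := diag_mx w^T in
  row_mx (u^T *m w - 1%:M)
   (row_mx (w^T *m r2 - E%:M)
     (row_mx (map_mx (@ln R) w + (1 + lamY y) *: u + muY y *: r2)^T
             (A^T *m W *m A *m x - A^T *m W *m b)^T)).

(* Transpose of the usual Jacobian matrix: 'd F y v = v *m 'J F y for row
   vectors v. *)
Definition Jmx (R : realType) (m n : nat) (A : 'M[R]_(m, n)) (b : 'cV[R]_m)
    (E : R) (y : 'rV[R]_(dimY m n)) : 'M[R]_(dimY m n) :=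
  jacobian (Fmap A b E) y.

(* J(y)^{-1} e_2, written as a row vector; indices start at 0. *)
Definition vfield (R : realType) (m n : nat) (A : 'M[R]_(m, n)) (b : 'cV[R]_m)
    (E : R) (y : 'rV[R]_(dimY m n)) : 'rV[R]_(dimY m n) :=
  delta_mx 0 (lift ord0 ord0) *m invmx (Jmx A b E y).

(* Solution of the initial value problem on the half-open interval
   ]Emin, E_uw]; at the right end point the derivative is one-sided.
   Positivity of w and invertibility of J state that y stays in the domain of
   the vector field (invmx is total). *)
Definition branch_solution (R : realType) (m n : nat) (A : 'M[R]_(m, n))
    (b : 'cV[R]_m) (Emin : R) (y : R -> 'rV[R]_(dimY m n)) : Prop :=
  let Euw := E_uw A b in
  [/\ forall E, Emin < E <= Euw ->
        [/\ forall i, 0 < wY (y E) i 0,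
            Jmx A b E (y E) \in unitmx
          & Fmap A b E (y E) = 0],
      forall E, Emin < E < Euw -> is_derive E 1 y (vfield A b E (y E)),
      h^-1 *: (y (Euw + h) - y Euw) @[h --> 0^'-] --> vfield A b Euw (y Euw)
    & y Euw = mkY (- (1 + ln (m%:R^-1))) 0 (const_mx m%:R^-1) (x_LS A b)].

(* The interval ]Emin, E_uw] is maximal: no solution lives further down. *)
Definition stationary_branch (R : realType) (m n : nat) (A : 'M[R]_(m, n))
    (b : 'cV[R]_m) (Emin : R) (y : R -> 'rV[R]_(dimY m n)) : Prop :=
  [/\ 0 <= Emin < E_uw A b,
      branch_solution A b Emin y
    & forall (a : R) (z : R -> 'rV[R]_(dimY m n)),
        branch_solution A b a z -> Emin <= a].

Definition supportS (R : realType) (m : nat) (w : R -> 'cV[R]_m) : {set 'I_m} :=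
  [set i | (0%:E < limf_einf (fun E : R => (w E i 0)%:E) (0 : R)^'+)%E]%SET.

Definition activeI (R : realType) (m n : nat) (A : 'M[R]_(m, n)) (s0 : R)
    (w : 'cV[R]_m) : {set 'I_m} :=
  [set i | s0 ^+ 2 / specnorm A ^+ 2 <= w i 0]%SET.

Definition rows_of (R : realType) (m n : nat) (S : {set 'I_m})
    (A : 'M[R]_(m, n)) : 'M[R]_(#|S|, n) :=
  rowsub (fun k : 'I_#|S| => enum_val k) A.

(* Main.v *)
Require Import Defs.
From mathcomp Require Import all_boot all_order all_algebra.
From mathcomp Require Import all_classical all_reals all_analysis.
From mathcomp Require Import ring lra.

Set Implicit Arguments.
Unset Strict Implicit.
Unset Printing Implicit Defensive.

Import Order.TTheory GRing.Theory Num.Theory.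
Import numFieldNormedType.Exports.

Local Open Scope classical_set_scope.
Local Open Scope ring_scope.

(** On the branch the stationarity equations hold, [x] is continuous, and
[A^T W A] stays coercive.  Write [r = A x - b].

Convergence of [x].  A row whose weight stays above a fixed threshold has
[r_i^2 <= E / threshold], because [\sum_i w_i r_i^2 = E].  By coercivity the
heavy rows determine a point of R^n: lighter rows could not carry the lower
bound ([coercive_restrict]).  So [x] is within [O(sqrt E)] of the least-squares
solution of some set of rows ([near_ls_point]).  There are finitely many such
points, and a continuous function that stays close to a finite set converges
([finite_limit]); call the limit [xs].

Let [S] be the set of rows that [xs] interpolates.  Off [S] the residual has a
nonzero limit, so [w_j r_j^2 <= E] forces [w_j --> 0]; hence coercivity survives
on [S] ([near_coercive_S]), the rows of [S] are injective, and they determine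
[xs] and number at least [n].  What remains is to show
that the weights on [S] become equal, that is, by [ln w_i = - (1 + lam) - mu
r_i^2], that [mu r_i^2 --> 0] there, although [mu] may be unbounded.  Two estimates
play against each other, with [p = \sum_(j notin S) w_j |r_j| --> 0]:
- the normal equations and coercivity on [S] give [|x - xs| = O(p)]
  ([error_bound]), hence [r_i = O(p)] on [S];
- comparing the logarithm of a vanishing weight [w_j] with that of a weight that
  is at least [1/m] gives [mu > 0] and [mu w_j = O(1)] ([multiplier_bound]), hence
  [mu p = O(1)].
Together [mu r_i^2 = O(mu p^2) = O(p) --> 0] ([multiplier_residual_cvg0]), and
the weights on [S], whose sum tends to 1, tend to [1 / #|S|].

The claim on the active set needs more than the limit: a weight could tend to
[s0^2 / |A|^2] from below.  This is excluded by the strict inequality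
[s0^2 / |A|^2 < 1 / #|S|] ([threshold_lt]). *)

(** * Euclidean and spectral norms, coercive quadratic forms *)

Lemma norm2_ge0 (R : realType) (k : nat) (v : 'cV[R]_k) : 0 <= norm2 v.
Proof. exact: sqrtr_ge0. Qed.

Lemma sqr_norm2 (R : realType) (k : nat) (v : 'cV[R]_k) :
  norm2 v ^+ 2 = \sum_(i < k) v i 0 ^+ 2.
Proof. by rewrite sqr_sqrtr // sumr_ge0 // => i _; rewrite sqr_ge0. Qed.

Lemma norm2_eq0 (R : realType) (k : nat) (v : 'cV[R]_k) : norm2 v = 0 -> v = 0.
Proof.
move=> v0; have : \sum_(i < k) v i 0 ^+ 2 = 0 by rewrite -sqr_norm2 v0 expr0n.
move=> /eqP; rewrite psumr_eq0 => [/allP v_0|i _]; last exact: sqr_ge0.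
apply/colP => i; rewrite mxE; apply/eqP; rewrite -sqrf_eq0.
by apply: v_0; rewrite mem_index_enum.
Qed.

Lemma norm2Z (R : realType) (k : nat) (a : R) (v : 'cV[R]_k) :
  norm2 (a *: v) = `|a| * norm2 v.
Proof.
rewrite /norm2 -sqrtr_sqr -sqrtrM ?sqr_ge0 // mulr_sumr.
by congr Num.sqrt; apply: eq_bigr => i _; rewrite mxE exprMn.
Qed.

Lemma abs_coord_le_norm2 (R : realType) (k : nat) (v : 'cV[R]_k) i :
  `|v i 0| <= norm2 v.
Proof.
rewrite -(@ler_pXn2r _ 2) ?nnegrE ?norm2_ge0 // sqr_norm2 real_normK ?num_real //.
by rewrite (bigD1 i) //= lerDl sumr_ge0 // => j _; rewrite sqr_ge0.
Qed.

Lemma has_ubound_specnorm (R : realType) (m n : nat) (A : 'M[R]_(m, n)) :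
  has_ubound [set norm2 (A *m z) | z in [set z : 'cV[R]_n | norm2 z <= 1]].
Proof.
exists (Num.sqrt (\sum_i (\sum_j `|A i j|) ^+ 2)) => _ [v /= v1 <-].
apply: ler_wsqrtr; apply: ler_sum => i _.
rewrite -(real_normK (num_real ((A *m v) i 0))) lerXn2r ?nnegrE ?sumr_ge0 //.
rewrite mxE; apply: le_trans (ler_norm_sum _ _ _) _; apply: ler_sum => j _.
rewrite normrM ler_piMr //; exact: le_trans (abs_coord_le_norm2 v j) v1.
Qed.

Lemma specnorm_ge0 (R : realType) (m n : nat) (A : 'M[R]_(m, n)) : 0 <= specnorm A.
Proof.
apply: le_trans (norm2_ge0 (A *m 0)) _.
apply: ub_le_sup; first exact: has_ubound_specnorm.
exists 0 => //=; rewrite /norm2 big1 ?sqrtr0 // => i _.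
by rewrite mxE expr0n.
Qed.

Lemma norm2_mulmx_le (R : realType) (m n : nat) (A : 'M[R]_(m, n)) z :
  norm2 (A *m z) <= specnorm A * norm2 z.
Proof.
have [z0|z_neq0] := eqVneq (norm2 z) 0.
  rewrite z0 mulr0 (norm2_eq0 z0) mulmx0 /norm2 big1 ?sqrtr0 // => i _.
  by rewrite mxE expr0n.
have z_gt0 : 0 < norm2 z by rewrite lt_neqAle eq_sym z_neq0 norm2_ge0.
rewrite -ler_pdivrMr //.
have -> : norm2 (A *m z) / norm2 z = norm2 (A *m ((norm2 z)^-1 *: z)).
  by rewrite -scalemxAr norm2Z ger0_norm ?invr_ge0 ?norm2_ge0 // mulrC.
apply: ub_le_sup; first exact: has_ubound_specnorm.
exists ((norm2 z)^-1 *: z) => //=.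
by rewrite norm2Z ger0_norm ?invr_ge0 ?norm2_ge0 // mulVf.
Qed.

Lemma weighted_form (R : realType) (m n : nat) (A : 'M[R]_(m, n))
    (w c : 'cV[R]_m) (z : 'cV[R]_n) :
  (z^T *m (A^T *m diag_mx w^T *m c)) 0 0 =
  \sum_i w i 0 * c i 0 * (A *m z) i 0.
Proof.
rewrite !mulmxA -trmx_mul -mulmxA mxE; apply: eq_bigr => i _.
rewrite mul_diag_mx !mxE; ring.
Qed.

Lemma inj_row_free_tr (R : realType) (p n : nat) (M : 'M[R]_(p, n)) :
  (forall v : 'cV[R]_n, M *m v = 0 -> v = 0) -> row_free M^T.
Proof.
move=> Minj; rewrite -kermx_eq0; apply/eqP/row_matrixP => i; rewrite row0.
apply: trmx_inj; rewrite trmx0; apply: Minj; apply: trmx_inj.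
by rewrite trmx_mul trmxK trmx0 -row_mul mulmx_ker row0.
Qed.

(** The dropped rows contribute at most [tau |A v|^2 <= tau |A|^2 |v|^2], which
is at most half of the lower bound. *)
Lemma coercive_restrict (R : realType) (m n : nat) (A : 'M[R]_(m, n))
    (w : 'cV[R]_m) (c tau : R) (I : {set 'I_m}) :
  0 <= tau -> tau * specnorm A ^+ 2 <= c / 2 ->
  (forall v, c * norm2 v ^+ 2 <= \sum_i w i 0 * (A *m v) i 0 ^+ 2) ->
  (forall i, i \notin I -> w i 0 <= tau) ->
  forall v, c / 2 * norm2 v ^+ 2 <= \sum_(i in I) w i 0 * (A *m v) i 0 ^+ 2.
Proof.
move=> tau0 tau_small coercive w_small v.
have off : \sum_(i | i \notin I) w i 0 * (A *m v) i 0 ^+ 2 <= c / 2 * norm2 v ^+ 2.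
  apply: (@le_trans _ _ (\sum_(i | i \notin I) tau * (A *m v) i 0 ^+ 2)).
    by apply: ler_sum => i iI; rewrite ler_wpM2r ?sqr_ge0 ?w_small.
  rewrite -mulr_sumr; apply: (@le_trans _ _ (tau * norm2 (A *m v) ^+ 2)).
    rewrite ler_wpM2l // sqr_norm2 [leRHS](bigID (mem I)) /= lerDr sumr_ge0 // => i _.
    exact: sqr_ge0.
  apply: (@le_trans _ _ (tau * (specnorm A * norm2 v) ^+ 2)).
    by rewrite ler_wpM2l // lerXn2r ?nnegrE ?norm2_ge0 ?norm2_mulmx_le //;
       apply: le_trans (norm2_mulmx_le A v); exact: norm2_ge0.
  by rewrite exprMn mulrA ler_wpM2r ?sqr_ge0.
have := coercive v; rewrite (bigID (mem I)) /= => full.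
lra.
Qed.

(** Least-squares solution of the rows in [I]: with [P] the projection onto these
rows, the solution of [A^T P A z = A^T P b]. *)
Definition ls_point (R : realType) (m n : nat) (A : 'M[R]_(m, n))
    (b : 'cV[R]_m) (I : {set 'I_m}) : 'cV[R]_n :=
  let P := diag_mx (\row_i (i \in I)%:R) in invmx (A^T *m P *m A) *m (A^T *m P *m b).

(** Pseudo-inverse of the rows in [I], padded by zero columns off [I]. *)
Definition ls_gain (R : realType) (m n : nat) (A : 'M[R]_(m, n))
    (I : {set 'I_m}) : 'M[R]_(n, m) :=
  let P := diag_mx (\row_i (i \in I)%:R) in invmx (A^T *m P *m A) *m (A^T *m P).

Lemma ls_gain_off (R : realType) (m n : nat) (A : 'M[R]_(m, n)) (I : {set 'I_m}) k i :
  i \notin I -> ls_gain A I k i = 0.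
Proof.
move=> iI; rewrite /ls_gain mxE big1 // => j _.
by rewrite mul_mx_diag !mxE (negbTE iI) mulr0n !mulr0.
Qed.

(** Even when the rows in [I] are inconsistent, [x] misses their least-squares
solution by a linear function of its own residuals on [I], so small residuals
mean a small distance. *)
Lemma sub_ls_point (R : realType) (m n : nat) (A : 'M[R]_(m, n)) (b : 'cV[R]_m)
    (I : {set 'I_m}) (x : 'cV[R]_n) :
  (forall v : 'cV[R]_n, (forall i, i \in I -> (A *m v) i 0 = 0) -> v = 0) ->
  x - ls_point A b I = ls_gain A I *m (A *m x - b).
Proof.
move=> Iinj; rewrite /ls_point /ls_gain.
set P := diag_mx _; set G := A^T *m P *m A.
have Gunit : G \in unitmx.
  rewrite -unitmx_tr -row_free_unit; apply: inj_row_free_tr => v Gv0.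
  (* The quadratic form of the Gram matrix G sums the squares of A v over I. *)
  have : (v^T *m (A^T *m P *m (A *m v))) 0 0 = 0.
    by rewrite [_ *m P *m _]mulmxA -/G Gv0 mulmx0 mxE.
  rewrite /P -[X in diag_mx X]trmxK weighted_form // => /eqP.
  rewrite psumr_eq0 => [/allP Av0|i _]; last first.
    by rewrite -mulrA mulr_ge0 ?mxE // -expr2 sqr_ge0.
  apply: Iinj => i iI; have := Av0 i (mem_index_enum _).
  by rewrite !mxE iI /= mul1r -expr2 sqrf_eq0 => /eqP.
by rewrite -[RHS]mulmxA [X in _ = _ *m X]mulmxBr [_ *m (A *m x)]mulmxA [RHS]mulmxBr mulKmx.
Qed.

(** * Two facts on limits at [0^'+] *)

(** A continuous function cannot pass from the neighbourhood of one point of a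
finite set to that of another without taking a value far from the whole set. *)
Lemma finite_limit (R : realType) (I : finType) (f : I -> R) (g : R -> R) (e : R) :
  0 < e -> (forall t, 0 < t < e -> {for t, continuous g}) ->
  (forall eps, 0 < eps ->
     \forall t \near (0 : R)^'+, exists i, `|g t - f i| < eps) ->
  exists l : R, g t @[t --> (0 : R)^'+] --> l.
Proof.
move=> e0 gcont gnear.
(* Distance 3 eta leaves a gap of length eta between neighbourhoods of radius eta. *)
have [eta [eta0 gap]] : exists eta, 0 < eta /\
    forall i j, f i != f j -> 3 * eta <= `|f i - f j|.
  have : \forall eta \near (0 : R)^'+, forall ij : I * I,
      f ij.1 != f ij.2 -> 3 * eta <= `|f ij.1 - f ij.2|.
    apply: filter_forall => ij; have [->|ne] := eqVneq (f ij.1) (f ij.2).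
      exact: nearW.
    have d0 : 0 < `|f ij.1 - f ij.2| / 3 by rewrite divr_gt0 // normr_gt0 subr_eq0.
    near=> eta => _.
    have : eta <= `|f ij.1 - f ij.2| / 3 by near: eta; exact: nbhs_right_le.
    by rewrite ler_pdivlMr // mulrC.
  move=> gapE; have [eta [eta0 H]] :
      exists eta : R, 0 < eta /\ forall ij : I * I,
        f ij.1 != f ij.2 -> 3 * eta <= `|f ij.1 - f ij.2|.
    near (0 : R)^'+ => eta; exists eta; split; near: eta => //.
    exact: nbhs_right_gt.
  by exists eta; split=> // i j; exact: (H (i, j)).
have [d [d0 dP]] : exists d, 0 < d /\
    forall t, 0 < t <= d -> t < e /\ exists i, `|g t - f i| < eta.
  have [d /= d0 dP] := gnear _ eta0.
  exists (Num.min (d / 2) (e / 2)); rewrite lt_min !divr_gt0 //; split=> // t.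
  rewrite le_min => /andP[t0 /andP[td te]]; split.
    by rewrite (le_lt_trans te) // ltr_pdivrMr // ltr_pMr // ltr1n.
  apply: dP => //=; rewrite sub0r normrN gtr0_norm // (le_lt_trans td) //.
  by rewrite ltr_pdivrMr // ltr_pMr // ltr1n.
have gd := (dP d); have [|_ [i0 gi0]] := gd; first by rewrite d0 lexx.
(* By the intermediate value theorem g would take a value v at distance 3/2 eta
   from f i, on the side of f i0; every other point is 3 eta away from f i, hence
   at least 3/2 eta away from v. *)
have stay t i : 0 < t <= d -> `|g t - f i| < eta -> f i = f i0.
  move=> /andP[t0 td] gi; apply/eqP/negPn/negP => ne.
  have cont : {within `[t, d], continuous g}.
    apply: continuous_in_subspaceT => z /[!inE] /=; rewrite in_itv /= => /andP[tz zd].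
    apply: gcont; rewrite (lt_le_trans t0 tz) /=.
    by have [|] := dP z; rewrite ?(lt_le_trans t0 tz).
  have hgap := gap _ _ ne.
  have [v [v_between v_far]] : exists v,
     Num.min (g t) (g d) <= v <= Num.max (g t) (g d) /\ forall j, eta <= `|v - f j|.
    exists (if f i < f i0 then f i + 3 / 2 * eta else f i - 3 / 2 * eta).
    split.
      move: hgap gi gi0; rewrite ge_min le_max !ltr_norml.
      case: (ltrP (f i) (f i0)) => ii0.
        by move=> hg /andP[? ?] /andP[? ?]; apply/andP; split; apply/orP; [left|right]; lra.
      by move=> hg /andP[? ?] /andP[? ?]; apply/andP; split; apply/orP; [right|left]; lra.
    move=> j; have [fji|/gap] := eqVneq (f j) (f i).
      by rewrite fji; case: ifP => _; rewrite ler_normr; apply/orP; [left|right]; lra.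
    rewrite !ler_normr; case: ifP => _ /orP[|] h; apply/orP.
    - by right; lra.
    - by left; lra.
    - by right; lra.
    - by left; lra.
  have [z /[!in_itv]/= /andP[tz zd] gz] := IVT td cont v_between.
  have [|_ [j]] := dP z; first by rewrite (lt_le_trans t0 tz).
  by rewrite gz ltNge v_far.
exists (f i0); apply/cvgrPdist_lt => eps eps0.
near=> t; rewrite distrC.
have [i] : exists i, `|g t - f i| < Num.min eps eta.
  by near: t; apply: gnear; rewrite lt_min eps0.
rewrite lt_min => /andP[gi1 gi2]; rewrite -(stay t i) //.
by apply/andP; split; near: t; [exact: nbhs_right_gt|exact: nbhs_right_le].
Unshelve. all: by end_near. Qed.

Lemma limf_einf_gt0 (R : realType) (g : R -> R) (l : R) :
  g t @[t --> (0 : R)^'+] --> l -> 0 <= l ->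
  (0%:E < limf_einf (fun t => (g t)%:E) (0 : R)^'+)%E = (0 < l).
Proof.
move=> gl l_ge0; rewrite limf_einfE; apply/idP/idP.
  apply: contraTT; rewrite -!leNgt => l_le0.
  have {l_le0 l_ge0} l0 : l = 0 by apply/le_anti/andP.
  apply: ge_ereal_sup => _ [V FV <-]; apply/lee_addgt0Pr => eps eps0.
  have [t [Vt gt]] : exists t, V t /\ g t < eps.
    near (0 : R)^'+ => t; exists t; split; near: t => //.
    by apply: (cvgr_lt l gl); rewrite l0.
  rewrite add0e; apply: ge_ereal_inf; exists (g t)%:E; first by exists t.
  by rewrite lee_fin ltW.
move=> l0; apply: (@lt_le_trans _ _ (l / 2)%:E); first by rewrite lte_fin divr_gt0.
apply: le_trans (ereal_sup_ubound _); last first.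
  exists [set t | l / 2 <= g t] => //.
  by apply: (cvgr_ge l gl); rewrite ltr_pdivrMr // ltr_pMr // ltr1n.
by apply: le_ereal_inf_tmp => _ [t /= ht <-]; rewrite lee_fin.
Unshelve. all: by end_near. Qed.

Lemma cvg_colP (R : realType) (n : nat) (x : R -> 'cV[R]_n) (F : set_system R)
    (l : 'cV[R]_n) : Filter F ->
  (forall k, x t k 0 @[t --> F] --> l k 0) -> x t @[t --> F] --> l.
Proof.
move=> FF xl; apply/cvgrPdist_lt => eps eps0.
have : \forall t \near F, forall k, `|l k 0 - x t k 0| < eps.
  by apply: filter_forall => k; have /cvgrPdist_lt := xl k; exact.
apply: filterS => t ht; rewrite [ltLHS]/Num.norm /= mx_normrE.
by apply: bigmax_lt => // -[i j] _ /=; rewrite ord1 !mxE.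
Qed.

Lemma cvg_sumr (R : realType) (T : Type) (F : set_system T) (I : finType)
    (P : pred I) (f : I -> T -> R) (l : I -> R) : Filter F ->
  (forall i, P i -> f i t @[t --> F] --> l i) ->
  \sum_(i | P i) f i t @[t --> F] --> \sum_(i | P i) l i.
Proof. by move=> FF; apply: cvg_big; exact: add_continuous. Qed.

(** * The stationarity equations at one value of [E] *)

(** Componentwise form of [F(y; E) = 0], with the normal equations tested against
vectors [A v]. *)
Definition stationary_at (R : realType) (m n : nat) (A : 'M[R]_(m, n))
    (b : 'cV[R]_m) (E lam mu : R) (w : 'cV[R]_m) (x : 'cV[R]_n) : Prop :=
  let r := A *m x - b in
  [/\ forall i, 0 < w i 0,
      \sum_i w i 0 = 1,
      \sum_i w i 0 * r i 0 ^+ 2 = E,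
      forall i, ln (w i 0) + (1 + lam) + mu * r i 0 ^+ 2 = 0
    & forall v : 'cV[R]_n, \sum_i w i 0 * r i 0 * (A *m v) i 0 = 0].

Section Stationary.
Variables (R : realType) (m n : nat) (A : 'M[R]_(m, n)) (b : 'cV[R]_m).
Variables (E lam mu : R) (w : 'cV[R]_m) (x : 'cV[R]_n).
Hypothesis stat : stationary_at A b E lam mu w x.
Let r := A *m x - b.

Lemma weight_gt0 i : 0 < w i 0. Proof. by case: stat. Qed.

Lemma weight_le1 i : w i 0 <= 1.
Proof.
have [_ <- _ _ _] := stat; rewrite (bigD1 i) //= lerDl sumr_ge0 // => j _.
exact/ltW/weight_gt0.
Qed.

Lemma weighted_residual_le i : w i 0 * r i 0 ^+ 2 <= E.
Proof.
have [_ _ <- _ _] := stat; rewrite (bigD1 i) //= lerDl sumr_ge0 // => j _.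
by rewrite mulr_ge0 ?sqr_ge0 // ltW ?weight_gt0.
Qed.

Lemma heavy_row : exists i, m%:R^-1 <= w i 0.
Proof.
apply/existsP; have [//|/existsPn light] := boolP [exists i, m%:R^-1 <= w i 0].
have [_ sum1 _ _ _] := stat.
have m_gt0 : (0 < m)%N.
  rewrite lt0n; apply/eqP => m0; move: sum1; rewrite big1 => [/eqP|[i]].
    by rewrite eq_sym oner_eq0.
  by move=> i0; exfalso; rewrite m0 in i0.
suff : \sum_i w i 0 < 1 by rewrite sum1 ltxx.
have -> : 1 = \sum_(i < m) (m%:R^-1 : R).
  by rewrite sumr_const card_ord -[RHS]mulr_natr mulVf // pnatr_eq0 -lt0n.
apply: ltr_sum => [|i _]; last by rewrite ltNge.
by apply/hasP; exists (Ordinal m_gt0); rewrite ?mem_index_enum.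
Qed.

Lemma log_weight_ratio i k :
  ln (w i 0) - ln (w k 0) = mu * (r k 0 ^+ 2 - r i 0 ^+ 2).
Proof.
have [_ _ _ lnw _] := stat; have := lnw i; have := lnw k; rewrite -/r => ? ?.
lra.
Qed.

(** The weight decreases as [r^2] increases, hence [mu > 0]; quantitatively
[mu delta <= ln (w_i / w_j) <= 1 / w_j], so that [mu] can blow up only where [w_j]
vanishes, and not faster than [1 / w_j]. *)
Lemma multiplier_bound i j delta : 0 < delta ->
  delta <= r j 0 ^+ 2 - r i 0 ^+ 2 -> w j 0 < w i 0 -> `|mu| * w j 0 <= delta^-1.
Proof.
move=> delta0 gap wji.
have logE : mu * (r j 0 ^+ 2 - r i 0 ^+ 2) = ln (w i 0 / w j 0).
  by rewrite ln_div ?posrE ?weight_gt0 // log_weight_ratio.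
have mu_gt0 : 0 < mu.
  rewrite -(pmulr_lgt0 _ (lt_le_trans delta0 gap)) logE ln_gt0 //.
  by rewrite ltr_pdivlMr ?weight_gt0 // mul1r.
rewrite gtr0_norm // -ler_pdivlMr ?weight_gt0 // -[leRHS]mulrC -ler_pdivrMr ?invr_gt0 //.
rewrite invrK; apply: (@le_trans _ _ (ln (w i 0 / w j 0))).
  by rewrite -logE ler_pM2l.
apply/ltW/(lt_le_trans (ln_sublinear _)).
  by rewrite divr_gt0 ?weight_gt0.
by rewrite ler_piMl ?weight_le1 // invr_ge0 ltW ?weight_gt0.
Qed.

Variables (I : {set 'I_m}) (xs : 'cV[R]_n) (c : R).
Hypothesis interp : forall i, i \in I -> (A *m xs) i 0 = b i 0.
Hypothesis coer :
  forall v, c * norm2 v ^+ 2 <= \sum_(i in I) w i 0 * (A *m v) i 0 ^+ 2.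

Lemma residual_on i : i \in I -> r i 0 = (A *m (x - xs)) i 0.
Proof. by move=> iI; rewrite mulmxBr /r !mxE -interp // !mxE. Qed.

Lemma balance (v : 'cV[R]_n) : \sum_(i in I) w i 0 * r i 0 * (A *m v) i 0 =
  - \sum_(i | i \notin I) w i 0 * r i 0 * (A *m v) i 0.
Proof.
have [_ _ _ _ normal] := stat; apply/eqP; rewrite -addr_eq0.
by rewrite -(bigID (mem I) xpredT (fun i => w i 0 * r i 0 * (A *m v) i 0)) /= normal.
Qed.

(** In the normal equations only the rows outside [I] pull [x] away from [xs]:
test them against [h = x - xs] and use the coercivity of the rows of [I]. *)
Lemma error_bound :
  c * norm2 (x - xs) <= specnorm A * \sum_(i | i \notin I) w i 0 * `|r i 0|.
Proof.
set h := x - xs.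
have [h0|h_neq0] := eqVneq (norm2 h) 0.
  rewrite h0 mulr0 mulr_ge0 ?sumr_ge0 // => [|i _]; last first.
    by rewrite mulr_ge0 // ltW // weight_gt0.
  exact: specnorm_ge0.
have h_gt0 : 0 < norm2 h by rewrite lt_neqAle eq_sym h_neq0 norm2_ge0.
rewrite -(ler_pM2r h_gt0) -mulrA -expr2; apply: (le_trans (coer h)).
have -> : \sum_(i in I) w i 0 * (A *m h) i 0 ^+ 2 =
    \sum_(i in I) w i 0 * r i 0 * (A *m h) i 0.
  by apply: eq_bigr => i iI; rewrite residual_on // expr2 mulrA.
rewrite balance; apply: le_trans (ler_norm _) _; rewrite normrN.
apply: le_trans (ler_norm_sum _ _ _) _.
rewrite mulrAC mulr_sumr; apply: ler_sum => i _.
rewrite !normrM gtr0_norm ?weight_gt0 // mulrC ler_wpM2r //.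
  by rewrite mulr_ge0 // ltW ?weight_gt0.
exact: le_trans (abs_coord_le_norm2 _ _) (norm2_mulmx_le _ _).
Qed.

End Stationary.

(** * From the branch to the stationarity equations *)

Lemma wY_mkY (R : realType) (m n : nat) (lam mu : R) (w : 'cV[R]_m) (x : 'cV[R]_n) :
  wY (mkY lam mu w x) = w.
Proof. by rewrite /wY /mkY !(row_mxKr, row_mxKl) trmxK. Qed.

Lemma xY_mkY (R : realType) (m n : nat) (lam mu : R) (w : 'cV[R]_m) (x : 'cV[R]_n) :
  xY (mkY lam mu w x) = x.
Proof. by rewrite /xY /mkY !row_mxKr trmxK. Qed.

Lemma Fmap0_stationary (R : realType) (m n : nat) (A : 'M[R]_(m, n))
    (b : 'cV[R]_m) (E lam mu : R) (w : 'cV[R]_m) (x : 'cV[R]_n) :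
  (forall i, 0 < w i 0) -> Fmap A b E (mkY lam mu w x) = 0 ->
  stationary_at A b E lam mu w x.
Proof.
move=> w_gt0; rewrite /Fmap wY_mkY xY_mkY.
have -> : lamY (mkY lam mu w x) = lam by rewrite /lamY /mkY row_mxKl mxE eqxx.
have -> : muY (mkY lam mu w x) = mu.
  by rewrite /muY /mkY row_mxKr row_mxKl mxE eqxx.
rewrite -!row_mx0 => /eq_row_mx[F1 /eq_row_mx[F2 /eq_row_mx[F3 F4]]].
split=> // [||i|v].
- have := congr1 (fun M : 'M[R]_1 => M 0 0) F1; rewrite !mxE => /eqP.
  rewrite subr_eq0 => /eqP; rewrite mulr1n => <-.
  by apply: eq_bigr => i _; rewrite !mxE mul1r.
- have := congr1 (fun M : 'M[R]_1 => M 0 0) F2; rewrite !mxE => /eqP.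
  rewrite subr_eq0 => /eqP; rewrite mulr1n => <-.
  by apply: eq_bigr => i _; rewrite !mxE.
- have := congr1 (fun M : 'rV[R]_m => M 0 i) F3.
  by rewrite !mxE mulr1.
- rewrite -weighted_form.
  have normal : A^T *m diag_mx w^T *m (A *m x - b) = 0.
    rewrite mulmxBr [_ *m (A *m x)]mulmxA.
    by apply: trmx_inj; rewrite F4 trmx0.
  by rewrite -[X in _ *m X]/(A^T *m diag_mx w^T *m (A *m x - b)) normal mulmx0 mxE.
Qed.

Lemma branch_stationary (R : realType) (m n : nat) (A : 'M[R]_(m, n))
    (b : 'cV[R]_m) (Emin : R) (lam mu : R -> R) (w : R -> 'cV[R]_m)
    (x : R -> 'cV[R]_n) (E : R) :
  branch_solution A b Emin (fun E => mkY (lam E) (mu E) (w E) (x E)) ->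
  Emin < E <= E_uw A b -> stationary_at A b E (lam E) (mu E) (w E) (x E).
Proof.
move=> [onF _ _ _] /onF[w_gt0 _ F0]; apply: Fmap0_stationary => // i.
by have := w_gt0 i; rewrite wY_mkY.
Qed.

Lemma branch_continuous (R : realType) (m n : nat) (A : 'M[R]_(m, n))
    (b : 'cV[R]_m) (Emin : R) (lam mu : R -> R) (w : R -> 'cV[R]_m)
    (x : R -> 'cV[R]_n) (E : R) k :
  branch_solution A b Emin (fun E => mkY (lam E) (mu E) (w E) (x E)) ->
  Emin < E < E_uw A b -> {for E, continuous (fun E => x E k 0)}.
Proof.
move=> [_ der _ _] /der[derE _].
have ycont := differentiable_continuous (iffLR (derivable1_diffP _ _) derE).
have -> : (fun E => x E k 0) = fun E =>
    mkY (lam E) (mu E) (w E) (x E) 0 (rshift 1 (rshift 1 (rshift m k))).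
  by apply/funext => t; rewrite /mkY !row_mxEr mxE.
exact: (continuous_comp ycont (@coord_continuous _ _ _ _ _ _)).
Qed.

(** * The limit along the branch *)

Section Limit.
Variables (R : realType) (m n : nat) (A : 'M[R]_(m, n)) (b : 'cV[R]_m).
Variables (lam mu : R -> R) (w : R -> 'cV[R]_m) (x : R -> 'cV[R]_n).
Hypothesis n_gt0 : (0 < n)%N.
Hypothesis stat : \forall E \near (0 : R)^'+,
  stationary_at A b E (lam E) (mu E) (w E) (x E).
Let r : R -> 'cV[R]_m := fun E => A *m x E - b.
Variable c : R.
Hypothesis c_gt0 : 0 < c.
Hypothesis coer : \forall E \near (0 : R)^'+, forall v,
  c * norm2 v ^+ 2 <= \sum_i w E i 0 * (A *m v) i 0 ^+ 2.

Lemma norm2_ones_gt0 : 0 < norm2 (const_mx 1 : 'cV[R]_n).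
Proof.
rewrite lt_neqAle norm2_ge0 andbT eq_sym; apply/eqP => /norm2_eq0.
move=> /colP /(_ (Ordinal n_gt0)); rewrite !mxE => /eqP.
by rewrite oner_eq0.
Qed.

Lemma specnorm_gt0 : 0 < specnorm A.
Proof.
rewrite lt_neqAle specnorm_ge0 andbT eq_sym; apply/eqP => A0.
near (0 : R)^'+ => E.
have coerE : forall v, c * norm2 v ^+ 2 <= \sum_i w E i 0 * (A *m v) i 0 ^+ 2.
  by near: E.
have := coerE (const_mx 1); apply/negP; rewrite -ltNge big1.
  by rewrite mulr_gt0 // exprn_gt0 // norm2_ones_gt0.
move=> i _; suff -> : A *m const_mx 1 = 0 :> 'cV_m by rewrite mxE expr0n mulr0.
apply: norm2_eq0; apply/le_anti; rewrite norm2_ge0 andbT.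
by rewrite (le_trans (norm2_mulmx_le _ _)) // A0 mul0r.
Unshelve. all: by end_near. Qed.

(* With half of the threshold c / |A|^2, the heavier rows keep the constant c / 2. *)
Let tau := c / 2 / specnorm A ^+ 2.

Lemma tau_gt0 : 0 < tau.
Proof. by rewrite !divr_gt0 // exprn_gt0 // specnorm_gt0. Qed.

Lemma near_coercive_restrict : \forall E \near (0 : R)^'+, forall I : {set 'I_m},
  (forall i, i \notin I -> w E i 0 <= tau) ->
  forall v, c / 2 * norm2 v ^+ 2 <= \sum_(i in I) w E i 0 * (A *m v) i 0 ^+ 2.
Proof.
apply: filterS coer => E coerE I small.
apply: coercive_restrict small => //; first exact/ltW/tau_gt0.
by rewrite divfK // expf_neq0 // gt_eqF // specnorm_gt0.
Qed.

Lemma coercive_inj E (I : {set 'I_m}) :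
  (forall v, c / 2 * norm2 v ^+ 2 <= \sum_(i in I) w E i 0 * (A *m v) i 0 ^+ 2) ->
  forall v : 'cV[R]_n, (forall i, i \in I -> (A *m v) i 0 = 0) -> v = 0.
Proof.
move=> coerI v Av0; apply: norm2_eq0; apply/eqP; rewrite -sqrf_eq0.
have c2 : 0 < c / 2 by rewrite divr_gt0.
rewrite eq_le sqr_ge0 andbT -(pmulr_rle0 _ c2).
apply: le_trans (coerI v) _; rewrite big1 // => i iI.
by rewrite Av0 // expr0n mulr0.
Qed.

(** Take for [I] the rows of weight at least [tau]: their residuals are at most
[sqrt (E / tau)], and finitely many pseudo-inverses occur. *)
Lemma near_ls_point eps : 0 < eps -> \forall E \near (0 : R)^'+,
  exists I, forall k, `|x E k 0 - ls_point A b I k 0| < eps.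
Proof.
move=> eps0; pose K I k := \sum_i `|ls_gain A I k i|.
have K0 I k : 0 <= K I k by rewrite sumr_ge0.
have K1 I k : 0 < K I k + 1 by rewrite ltr_wpDl.
have small : \forall E \near (0 : R)^'+, forall Ik : {set 'I_m} * 'I_n,
    E < tau * (eps / (K Ik.1 Ik.2 + 1)) ^+ 2.
  apply: filter_forall => Ik; apply: nbhs_right_lt.
  by rewrite mulr_gt0 ?tau_gt0 // exprn_gt0 // divr_gt0.
near=> E.
have statE : stationary_at A b E (lam E) (mu E) (w E) (x E) by near: E.
pose I := [set i | tau <= w E i 0]%SET; exists I => k.
have smallE : E < tau * (eps / (K I k + 1)) ^+ 2.
  by apply: (near small E _ (I, k)).
have coerI : forall v,
    c / 2 * norm2 v ^+ 2 <= \sum_(i in I) w E i 0 * (A *m v) i 0 ^+ 2.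
  apply: (near near_coercive_restrict E) => // i.
  by rewrite inE -ltNge => /ltW.
have -> : x E k 0 - ls_point A b I k 0 = (x E - ls_point A b I) k 0 by rewrite !mxE.
rewrite (sub_ls_point _ _ (coercive_inj coerI)) mxE.
apply: le_lt_trans (ler_norm_sum _ _ _) _.
apply: (@le_lt_trans _ _ (\sum_i `|ls_gain A I k i| * (eps / (K I k + 1)))).
  apply: ler_sum => i _; rewrite normrM.
  have [iI|iI] := boolP (i \in I); last by rewrite ls_gain_off // normr0 !mul0r.
  have e_ge0 : 0 <= eps / (K I k + 1) by exact/ltW/divr_gt0.
  rewrite ler_wpM2l // -(@ler_pXn2r _ 2) ?nnegrE //.
  rewrite real_normK ?num_real // -(ler_pM2l tau_gt0).
  apply: le_trans (ltW smallE); apply: le_trans (weighted_residual_le statE i).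
  by rewrite ler_wpM2r ?sqr_ge0 //; move: iI; rewrite inE.
rewrite -mulr_suml -/(K I k) mulrA ltr_pdivrMr // mulrC ltr_pM2l //.
by rewrite ltrDl.
Unshelve. all: by end_near. Qed.

Lemma x_cvg e : 0 < e ->
  (forall k t, 0 < t < e -> {for t, continuous (fun E => x E k 0)}) ->
  exists xs : 'cV[R]_n, x E @[E --> (0 : R)^'+] --> xs.
Proof.
move=> e0 cont.
have exl : forall k, exists l : R, x E k 0 @[E --> (0 : R)^'+] --> l.
  move=> k; apply: (finite_limit (f := fun I => ls_point A b I k 0)) e0 _ _.
    exact: cont.
  by move=> eps /near_ls_point; apply: filterS => E [I]; exists I.
have [l xl] := choice exl.
by exists (\col_k l k); apply: cvg_colP => k; rewrite mxE.
Qed.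

Variable xs : 'cV[R]_n.
Hypothesis xcvg : x E @[E --> (0 : R)^'+] --> xs.
Let S := [set i | (A *m xs) i 0 == b i 0]%SET.
Let rs j := (A *m xs) j 0 - b j 0.

Lemma residual_cvg j : r E j 0 @[E --> (0 : R)^'+] --> rs j.
Proof.
have -> : (fun E => r E j 0 : R) =
    (fun E => \sum_k A j k * x E k 0 - b j 0).
  by apply/funext => E; rewrite /r !mxE.
rewrite /rs mxE; apply: cvgB; last exact: cvg_cst.
apply: cvg_sumr => k _; apply: cvgMl_tmp.
apply: (@continuous_cvg _ _ _ _ _ x (fun N : 'cV[R]_n => N k 0)) xcvg.
exact: coord_continuous.
Qed.

Lemma sqr_residual_cvg j :
  r E j 0 ^+ 2 @[E --> (0 : R)^'+] --> rs j ^+ 2.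
Proof.
rewrite !expr2; under eq_fun do rewrite expr2.
by apply: cvgM; exact: residual_cvg.
Qed.

Lemma rs_on i : i \in S -> rs i = 0.
Proof. by rewrite inE -subr_eq0 => /eqP. Qed.

Lemma rs_off j : j \notin S -> 0 < rs j ^+ 2.
Proof. by rewrite inE -subr_eq0 -/(rs j) => ?; rewrite exprn_even_gt0. Qed.

Lemma near_far j : j \notin S ->
  \forall E \near (0 : R)^'+, rs j ^+ 2 / 2 < r E j 0 ^+ 2.
Proof.
move=> /rs_off rs0; apply: (cvgr_gt _ (@sqr_residual_cvg j)).
by rewrite ltr_pdivrMr // ltr_pMr // ltr1n.
Qed.

Lemma weight_off_cvg0 j : j \notin S -> w E j 0 @[E --> (0 : R)^'+] --> 0.
Proof.
move=> jS; have rs0 := rs_off jS; apply/cvgr0Pnorm_lt => eps eps0; near=> E.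
have statE : stationary_at A b E (lam E) (mu E) (w E) (x E) by near: E.
have far : rs j ^+ 2 / 2 < r E j 0 ^+ 2.
  by near: E; exact: near_far.
have small : E < eps * (rs j ^+ 2 / 2).
  by near: E; apply: nbhs_right_lt; rewrite mulr_gt0 // divr_gt0.
have w_gt0 := weight_gt0 statE j; rewrite gtr0_norm // ltNge; apply/negP => epsw.
have := weighted_residual_le statE j; apply/negP; rewrite -ltNge.
apply: (lt_le_trans small); apply: ler_pM => //; first exact: ltW.
  by rewrite divr_ge0 // ltW.
exact: ltW.
Unshelve. all: by end_near. Qed.

(** Some row always has weight at least [1/m]; it provides the comparison weight
in [near_multiplier_bound]. *)
Lemma near_heavy_in_S : \forall E \near (0 : R)^'+,
  forall i, m%:R^-1 <= w E i 0 -> i \in S.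
Proof.
apply: filter_forall => i; have [iS|iS] := boolP (i \in S); first exact: nearW.
have m_gt0 : (0 < m)%N := leq_ltn_trans (leq0n i) (ltn_ord i).
have light : \forall E \near (0 : R)^'+, w E i 0 < m%:R^-1.
  by apply: (cvgr_lt _ (weight_off_cvg0 iS)); rewrite invr_gt0 ltr0n.
by apply: filterS light => E; rewrite ltNge => /negbTE ->.
Qed.

Lemma near_coercive_S : \forall E \near (0 : R)^'+,
  forall v, c / 2 * norm2 v ^+ 2 <= \sum_(i in S) w E i 0 * (A *m v) i 0 ^+ 2.
Proof.
have small : \forall E \near (0 : R)^'+, forall i, i \notin S -> w E i 0 <= tau.
  apply: filter_forall => i; have [iS|iS] := boolP (i \in S); first exact: nearW.
  near=> E => _; near: E; apply: (cvgr_le _ (weight_off_cvg0 iS)).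
  exact: tau_gt0.
near=> E; apply: (near near_coercive_restrict E) => //.
by apply: (near small E).
Unshelve. all: by end_near. Qed.

(** Eventually [r_j^2 > rs_j^2 / 2] while the residuals on [S] are below
[rs_j^2 / 4] in square, so [rs_j^2 / 4] is a valid gap. *)
Lemma near_multiplier_bound j : j \notin S -> \forall E \near (0 : R)^'+,
  `|mu E| * w E j 0 <= (rs j ^+ 2 / 4)^-1.
Proof.
move=> jS; have rs0 := rs_off jS.
have m_gt0 : (0 < m)%N := leq_ltn_trans (leq0n j) (ltn_ord j).
have close : \forall E \near (0 : R)^'+, forall i, i \in S ->
    r E i 0 ^+ 2 < rs j ^+ 2 / 4.
  apply: filter_forall => i; have [iS|iS] := boolP (i \in S); last exact: nearW.
  near=> E => _; near: E; apply: (cvgr_lt _ (@sqr_residual_cvg i)).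
  by rewrite rs_on // expr0n divr_gt0.
near=> E.
have statE : stationary_at A b E (lam E) (mu E) (w E) (x E) by near: E.
have [i heavy] := heavy_row statE.
have iS : i \in S by apply: (near near_heavy_in_S E).
apply: (multiplier_bound statE (i := i)); first by rewrite divr_gt0.
  have far : rs j ^+ 2 / 2 < r E j 0 ^+ 2.
    by near: E; exact: near_far.
  have closeE : r E i 0 ^+ 2 < rs j ^+ 2 / 4 by apply: (near close E).
  lra.
apply: lt_le_trans heavy.
by near: E; apply: (cvgr_lt _ (weight_off_cvg0 jS)); rewrite invr_gt0 ltr0n.
Unshelve. all: by end_near. Qed.

Let p E := \sum_(j | j \notin S) w E j 0 * `|r E j 0|.

Lemma p_cvg0 : p E @[E --> (0 : R)^'+] --> 0.
Proof.
have E0 : \sum_(j | j \notin S) 0 * `|rs j| = 0 :> R.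
  by rewrite big1 // => j _; rewrite mul0r.
rewrite -[X in _ --> X]E0.
apply: cvg_sumr => j jS.
exact: (cvgM (weight_off_cvg0 jS) (cvg_norm (@residual_cvg j))).
Qed.

Lemma multiplier_p_bound : exists C, \forall E \near (0 : R)^'+, `|mu E| * p E <= C.
Proof.
exists (\sum_(j | j \notin S) (rs j ^+ 2 / 4)^-1 * (`|rs j| + 1)).
have bound : \forall E \near (0 : R)^'+, forall j, j \notin S ->
    `|mu E| * w E j 0 <= (rs j ^+ 2 / 4)^-1 /\ `|r E j 0| <= `|rs j| + 1.
  apply: filter_forall => j; have [jS|jS] := boolP (j \in S); first exact: nearW.
  near=> E => _; split; near: E; first exact: near_multiplier_bound.
  by apply: (cvgr_norm_le _ (@residual_cvg j)); rewrite ltrDl.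
near=> E; rewrite /p mulr_sumr; apply: ler_sum => j jS.
have [muw rj] : `|mu E| * w E j 0 <= (rs j ^+ 2 / 4)^-1 /\ `|r E j 0| <= `|rs j| + 1.
  by apply: (near bound E).
have w_ge0 : 0 <= w E j 0.
  have statE : stationary_at A b E (lam E) (mu E) (w E) (x E) by near: E.
  exact/ltW/(weight_gt0 statE).
by rewrite mulrA ler_pM // mulr_ge0.
Unshelve. all: by end_near. Qed.

(** Here [r_i = O(p)], and one factor [p] is absorbed by the multiplier. *)
Lemma multiplier_residual_cvg0 i : i \in S ->
  mu E * r E i 0 ^+ 2 @[E --> (0 : R)^'+] --> 0.
Proof.
move=> iS; have [C muC] := multiplier_p_bound.
pose K := (specnorm A ^+ 2 / (c / 2)) ^+ 2.
have c2 : 0 < c / 2 by rewrite divr_gt0.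
apply/norm_cvg0P; apply: (@squeeze_cvgr _ _ _ _ (fun=> 0) (fun E => K * C * p E)).
- near=> E; rewrite normr_ge0 /=.
  have statE : stationary_at A b E (lam E) (mu E) (w E) (x E) by near: E.
  have coerE : forall v,
    c / 2 * norm2 v ^+ 2 <= \sum_(i in S) w E i 0 * (A *m v) i 0 ^+ 2.
    by near: E; exact: near_coercive_S.
  have interp k : k \in S -> (A *m xs) k 0 = b k 0 by rewrite inE => /eqP.
  have p_ge0 : 0 <= p E.
    by apply: sumr_ge0 => j _; rewrite mulr_ge0 // ltW // (weight_gt0 statE).
  have r_le : `|r E i 0| <= specnorm A ^+ 2 / (c / 2) * p E.
    rewrite /r (residual_on (x E) interp iS); apply: le_trans (abs_coord_le_norm2 _ _) _.
    apply: le_trans (norm2_mulmx_le _ _) _; rewrite expr2 -!mulrA.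
    rewrite ler_wpM2l ?specnorm_ge0 // [_ * p E]mulrC mulrA ler_pdivlMr //.
    by rewrite mulrC; exact: (error_bound statE interp coerE).
  rewrite normrM normrX; apply: (@le_trans _ _ (`|mu E| * (K * p E ^+ 2))).
    by rewrite ler_wpM2l // /K -exprMn lerXn2r ?nnegrE // (le_trans _ r_le).
  rewrite mulrCA -[K * C * _]mulrA ler_wpM2l ?sqr_ge0 // expr2 mulrA.
  by rewrite ler_wpM2r //; near: E.
- exact: cvg_cst.
- by rewrite -[X in _ --> X](mulr0 (K * C)); apply: cvgMl_tmp; exact: p_cvg0.
Unshelve. all: by end_near. Qed.

(** With [q_k = w_k / w_i --> 1], the weight is [w_i = (\sum_(k in S) w_k) /
\sum_(k in S) q_k]. *)
Lemma weight_on_cvg i : i \in S -> w E i 0 @[E --> (0 : R)^'+] --> (#|S|%:R^-1 : R).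
Proof.
move=> iS; have S_gt0 : (0 < #|S|)%N by apply/card_gt0P; exists i.
pose q E k := expR (mu E * r E i 0 ^+ 2 - mu E * r E k 0 ^+ 2).
have qcvg : \sum_(k in S) q E k @[E --> (0 : R)^'+] --> (#|S|%:R : R).
  have -> : #|S|%:R = \sum_(k in S) 1 :> R by rewrite sumr_const.
  apply: cvg_sumr => k kS; rewrite -[X in _ --> X]expR0.
  apply: continuous_cvg; first exact: continuous_expR.
  by rewrite -[X in _ --> X](subr0 0); apply: cvgB; exact: multiplier_residual_cvg0.
have total : 1 - \sum_(k | k \notin S) w E k 0 @[E --> (0 : R)^'+] --> (1 : R).
  rewrite -[X in _ --> X]subr0; apply: cvgB; first exact: cvg_cst.
  have E0 : \sum_(k | k \notin S) 0 = 0 :> R by rewrite big1.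
  rewrite -[X in _ --> X]E0.
  by apply: cvg_sumr => k; exact: weight_off_cvg0.
have S_neq0 : #|S|%:R != 0 :> R by rewrite pnatr_eq0 -lt0n.
rewrite -[X in _ --> X]mul1r; apply: cvg_trans (cvgM total (cvgV S_neq0 qcvg)).
apply: near_eq_cvg; near=> E.
have statE : stationary_at A b E (lam E) (mu E) (w E) (x E) by near: E.
have qE k : q E k = w E k 0 / w E i 0.
  rewrite /q -mulrBr -(log_weight_ratio statE k i) -ln_div ?posrE ?(weight_gt0 statE) //.
  by rewrite lnK // posrE divr_gt0 ?(weight_gt0 statE).
have [_ sum1 _ _ _] := statE; rewrite /=.
have -> : \sum_(k in S) q E k = (\sum_(k in S) w E k 0) / w E i 0.
  by rewrite mulr_suml; apply: eq_bigr => k _.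
have -> : 1 - \sum_(k | k \notin S) w E k 0 = \sum_(k in S) w E k 0.
  by rewrite -sum1 (bigID (mem S)) /= addrK.
rewrite invf_div mulrC divfK // gt_eqF // (bigD1 i) //= ltr_pwDl ?(weight_gt0 statE) //.
by apply: sumr_ge0 => k _; rewrite ltW // (weight_gt0 statE).
Unshelve. all: by end_near. Qed.

(** Otherwise the limit form [A_S^T A_S / #|S|] leaves no room: the rows off [S]
vanish, so the normal equations only see the consistent rows of [S], whose
residuals are then exactly zero and whose weights are equal already before the
limit.  Coercivity makes this common weight at least [1 / #|S|], so nothing is
left for rows off [S]; all residuals vanish, against [E > 0]. *)
Lemma threshold_lt : c / specnorm A ^+ 2 < #|S|%:R^-1.
Proof.
rewrite ltNge; apply/negP => S_small.
have spec_gt0 := specnorm_gt0; have spec2 : 0 < specnorm A ^+ 2 by rewrite exprn_gt0.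
near (0 : R)^'+ => E0.
have stat0 : stationary_at A b E0 (lam E0) (mu E0) (w E0) (x E0) by near: E0.
have S_gt0 : (0 < #|S|)%N.
  have [i heavy] := heavy_row stat0.
  by apply/card_gt0P; exists i; apply: (near near_heavy_in_S E0).
have S_gt0R : 0 < #|S|%:R :> R by rewrite ltr0n.
have limit_coer v : c * norm2 v ^+ 2 <= #|S|%:R^-1 * \sum_(i in S) (A *m v) i 0 ^+ 2.
  have cvg_form : \sum_i w E i 0 * (A *m v) i 0 ^+ 2 @[E --> (0 : R)^'+] -->
      (\sum_i (if i \in S then #|S|%:R^-1 else 0) * (A *m v) i 0 ^+ 2 : R).
    apply: cvg_sumr => i _; apply: cvgMr_tmp.
    by case: ifPn => iS; [exact: weight_on_cvg|exact: weight_off_cvg0].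
  have -> : #|S|%:R^-1 * \sum_(i in S) (A *m v) i 0 ^+ 2 =
      \sum_i (if i \in S then #|S|%:R^-1 else 0) * (A *m v) i 0 ^+ 2.
    rewrite mulr_sumr big_mkcond /=; apply: eq_bigr => i _.
    by case: ifP => // _; rewrite mul0r.
  by apply: (cvgr_to_ge cvg_form); apply: filterS coer => E; exact.
(* The rows of S alone already account for the full bound |A|^2 |v|^2. *)
have off0 (v : 'cV[R]_n) j : j \notin S -> (A *m v) j 0 = 0.
  move=> jS; have lower := limit_coer v.
  have mass : specnorm A ^+ 2 * norm2 v ^+ 2 <= \sum_(i in S) (A *m v) i 0 ^+ 2.
    rewrite -(ler_pM2l (_ : 0 < #|S|%:R^-1)) ?invr_gt0 //; apply: le_trans lower.
    by rewrite mulrA ler_wpM2r ?sqr_ge0 // -ler_pdivlMr.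
  have upper : norm2 (A *m v) ^+ 2 <= specnorm A ^+ 2 * norm2 v ^+ 2.
    rewrite -exprMn lerXn2r ?nnegrE ?norm2_ge0 ?mulr_ge0 ?norm2_ge0 ?specnorm_ge0 //.
    exact: norm2_mulmx_le.
  have := le_trans upper mass; rewrite sqr_norm2 (bigID (mem S)) /= gerDl => rest.
  apply/eqP; rewrite -sqrf_eq0 eq_le sqr_ge0 andbT; apply: le_trans rest.
  by rewrite (bigD1 j) //= lerDl sumr_ge0 // => k _; rewrite sqr_ge0.
have interp k : k \in S -> (A *m xs) k 0 = b k 0 by rewrite inE => /eqP.
have coer0 : forall v, c * norm2 v ^+ 2 <= \sum_i w E0 i 0 * (A *m v) i 0 ^+ 2.
  by near: E0.
have coerS0 : forall v,
  c / 2 * norm2 v ^+ 2 <= \sum_(i in S) w E0 i 0 * (A *m v) i 0 ^+ 2.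
  by near: E0; exact: near_coercive_S.
have r0 i : i \in S -> r E0 i 0 = 0.
  move=> iS; rewrite /r (residual_on (x E0) interp iS).
  suff -> : x E0 - xs = 0 by rewrite mulmx0 mxE.
  apply: norm2_eq0; apply/eqP; rewrite -sqrf_eq0 eq_le sqr_ge0 andbT.
  rewrite -(pmulr_rle0 _ (_ : 0 < c / 2)) ?divr_gt0 //.
  apply: le_trans (coerS0 _) _.
  have := balance stat0 S (x E0 - xs).
  rewrite [in RHS]big1 ?oppr0 => [|j jS]; last by rewrite off0 ?mulr0.
  move=> bal; rewrite -[leRHS]bal le_eqVlt; apply/orP; left; apply/eqP.
  by apply: eq_bigr => k kS; rewrite (residual_on (x E0) interp kS) expr2 mulrA.
have [i0 i0S] : exists i0, i0 \in S by apply/card_gt0P.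
have w_const i : i \in S -> w E0 i 0 = w E0 i0 0.
  move=> iS; have := log_weight_ratio stat0 i i0; rewrite -/(r E0) !r0 // subrr mulr0.
  by move=> /eqP; rewrite subr_eq0 => /eqP; apply: ln_inj; rewrite posrE (weight_gt0 stat0).
have w_ge : #|S|%:R^-1 <= w E0 i0 0.
  apply: (le_trans S_small); rewrite ler_pdivrMr //.
  have ones2 : 0 < norm2 (const_mx 1 : 'cV[R]_n) ^+ 2.
    by rewrite exprn_gt0 // norm2_ones_gt0.
  rewrite -(ler_pM2r ones2); apply: le_trans (coer0 _) _.
  rewrite -mulrA -exprMn; apply: (@le_trans _ _ (w E0 i0 0 * norm2 (A *m const_mx 1) ^+ 2)).
    rewrite sqr_norm2 mulr_sumr; apply: ler_sum => i _.
    have [iS|iS] := boolP (i \in S); first by rewrite w_const.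
    by rewrite off0 // expr0n !mulr0.
  rewrite ler_wpM2l //; first exact/ltW/(weight_gt0 stat0).
  rewrite lerXn2r ?nnegrE ?norm2_ge0 //.
    by rewrite mulr_ge0 ?norm2_ge0 ?specnorm_ge0.
  exact: norm2_mulmx_le.
have [_ sum1 sumE _ _] := stat0.
have all_in i : i \in S.
  apply/negPn/negP => iS.
  suff : w E0 i 0 <= 0 by rewrite leNgt (weight_gt0 stat0).
  have full : 1 <= \sum_(k in S) w E0 k 0.
    rewrite (eq_bigr _ w_const) sumr_const -[leRHS]mulr_natr.
    by rewrite -ler_pdivrMr // div1r.
  have := sum1; rewrite (bigID (mem S)) /= (bigD1 i iS) /= => sum1'.
  have rest : 0 <= \sum_(k | (k \notin S) && (k != i)) w E0 k 0.
    by apply: sumr_ge0 => k _; exact/ltW/(weight_gt0 stat0).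
  lra.
have : E0 = 0 by rewrite -sumE big1 // => i _; rewrite -/(r E0) r0 ?expr0n ?mulr0.
by apply/eqP; rewrite gt_eqF //; near: E0; exact: nbhs_right_gt.
Unshelve. all: by end_near. Qed.

Lemma unique_on_S (z : 'cV[R]_n) :
  (forall i, i \in S -> (A *m z) i 0 = 0) -> z = 0.
Proof.
near (0 : R)^'+ => E; apply: (coercive_inj (E := E)).
by near: E; exact: near_coercive_S.
Unshelve. all: by end_near. Qed.

Lemma supportS_limit : supportS w = S.
Proof.
apply/setP => i; have [iS|iS] := boolP (i \in S); rewrite inE.
  have S_gt0 : (0 < #|S|)%N by apply/card_gt0P; exists i.
  rewrite (limf_einf_gt0 (weight_on_cvg iS)) ?invr_ge0 ?ler0n //.
  by rewrite invr_gt0 ltr0n.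
by rewrite (limf_einf_gt0 (weight_off_cvg0 iS)) ?ltxx ?lexx.
Qed.

Lemma near_activeI (s0 : R) : s0 ^+ 2 = c ->
  \forall E \near (0 : R)^'+, S = activeI A s0 (w E).
Proof.
move=> s0c.
have : \forall E \near (0 : R)^'+,
    forall i, (i \in S) = (c / specnorm A ^+ 2 <= w E i 0).
  apply: filter_forall => i; have [iS|iS] := boolP (i \in S).
    near=> E; symmetry; near: E; apply: (cvgr_ge _ (weight_on_cvg iS)).
    exact: threshold_lt.
  near=> E; symmetry; apply/negbTE; rewrite -ltNge; near: E.
  apply: (cvgr_lt _ (weight_off_cvg0 iS)).
  by rewrite divr_gt0 // exprn_gt0 // specnorm_gt0.
by apply: filterS => E SE; apply/setP => i; rewrite SE inE s0c.
Unshelve. all: by end_near. Qed.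

End Limit.

(** * Rows indexed by a set, and the theorem *)

Lemma rows_of_mulmxE (R : realType) (m n p : nat) (S : {set 'I_m})
    (A : 'M[R]_(m, n)) (z : 'M[R]_(n, p)) : rows_of S A *m z = rows_of S (A *m z).
Proof. by apply/matrixP => k l; rewrite !mxE; apply: eq_bigr => j _; rewrite !mxE. Qed.

Lemma rows_of_eqP (R : realType) (m : nat) (S : {set 'I_m}) (u v : 'cV[R]_m) :
  rows_of S u = rows_of S v <-> forall i, i \in S -> u i 0 = v i 0.
Proof.
split=> [uv i iS|uv]; last first.
  by apply/colP => k; rewrite !mxE uv // enum_valP.
have := congr1 (fun M : 'cV[R]__ => M (enum_rank_in iS i) 0) uv.
by rewrite !mxE enum_rankK_in.
Qed.

Theorem proposition5 (R : realType) (m n : nat)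
    (n_gt0 : (0 < n)%N) (le_nm : (n <= m)%N)
    (A : 'M[R]_(m, n)) (b : 'cV[R]_m)
    (rankA : \rank A = n)
    (r_LS_nonconst : ~ exists c : R, forall i : 'I_m, `|r_LS A b i 0| = c)
    (lam mu : R -> R) (w : R -> 'cV[R]_m) (x : R -> 'cV[R]_n)
    (branch : stationary_branch A b 0
                (fun E : R => mkY (lam E) (mu E) (w E) (x E)))
    (s0 : R) (s0_gt0 : 0 < s0)
    (AWA_ge : \forall E \near (0 : R)^'+,
                psd_ge (A^T *m diag_mx (w E)^T *m A) (s0 ^+ 2)) :
  let S : {set 'I_m} := supportS w in
  let r : R -> 'cV[R]_m := fun E => A *m x E - b in
  [/\ (* (a) *)
      (\forall E \near (0 : R)^'+, S = activeI A s0 (w E)) /\ (n <= #|S|)%N,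
      (* (b) *)
      forall i : 'I_m, i \in S <-> (r E i 0 @[E --> (0 : R)^'+] --> (0 : R)),
      (* (c) *)
      forall i : 'I_m, i \notin S -> w E i 0 @[E --> (0 : R)^'+] --> (0 : R),
      (* (d) *)
      forall i : 'I_m, i \in S ->
        w E i 0 @[E --> (0 : R)^'+] --> (#|S|%:R^-1 : R)
    & (* (e) *)
      exists xs : 'cV[R]_n,
        [/\ unique (fun z : 'cV[R]_n => rows_of S A *m z = rows_of S b) xs,
            x E @[E --> (0 : R)^'+] --> xs,
            forall j : 'I_m,
              r E j 0 @[E --> (0 : R)^'+] --> ((row j A *m xs) 0 0 - b j 0 : R),
            forall i : 'I_m, i \in S -> (row i A *m xs) 0 0 - b i 0 = 0
          & forall j : 'I_m, j \notin S -> (row j A *m xs) 0 0 - b j 0 != 0]].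
Proof.
move=> S r; have [/andP[_ Euw_gt0] sol _] := branch.
have c_gt0 : 0 < s0 ^+ 2 by rewrite exprn_gt0.
have stat : \forall E \near (0 : R)^'+,
    stationary_at A b E (lam E) (mu E) (w E) (x E).
  near=> E; apply: (branch_stationary sol); apply/andP.
  by split; near: E; [exact: nbhs_right_gt|exact: nbhs_right_le].
have coer : \forall E \near (0 : R)^'+, forall v,
    s0 ^+ 2 * norm2 v ^+ 2 <= \sum_i w E i 0 * (A *m v) i 0 ^+ 2.
  apply: filterS AWA_ge => E psdE v; apply: le_trans (psdE v) _.
  rewrite -mulmxA -[_ *m A *m v]mulmxA weighted_form le_eqVlt.
  apply/orP; left; apply/eqP; apply: eq_bigr => i _.
  by rewrite expr2 mulrA.
have [xs xcvg] := x_cvg n_gt0 stat c_gt0 coer Euw_gt0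
  (fun k t => @branch_continuous _ _ _ _ _ _ _ _ _ _ t k sol).
have SE : S = [set i | (A *m xs) i 0 == b i 0]%SET.
  exact: (supportS_limit n_gt0 stat c_gt0 coer xcvg).
have uniq := unique_on_S n_gt0 stat c_gt0 coer xcvg.
have inS i : (i \in S) = ((A *m xs) i 0 - b i 0 == 0) by rewrite SE inE subr_eq0.
have rowE j : (row j A *m xs) 0 0 = (A *m xs) j 0 by rewrite -row_mul mxE.
have rcvg j : r E j 0 @[E --> (0 : R)^'+] --> ((A *m xs) j 0 - b j 0 : R).
  exact: (@residual_cvg _ _ _ A b x xs xcvg j).
rewrite -SE in uniq.
split.
- split; first by rewrite SE; exact: (near_activeI n_gt0 stat c_gt0 coer xcvg).
  have : row_free (rows_of S A)^T.
    apply: inj_row_free_tr => v; rewrite rows_of_mulmxE => Av0; apply: uniq.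
    have : rows_of S (A *m v) = rows_of S (0 : 'cV[R]_m).
      by rewrite Av0; apply/matrixP => k l; rewrite !mxE.
    by move=> /rows_of_eqP H i iS; rewrite H // mxE.
  by move=> /eqP <-; exact: rank_leq_col.
- move=> i; rewrite inS; split=> [/eqP rs0|ri0].
    by rewrite -[X in _ --> X]rs0; exact: rcvg.
  by apply/eqP; exact: (cvg_unique _ (@rcvg i) ri0).
- by move=> i; rewrite SE; exact: (weight_off_cvg0 stat xcvg).
- by move=> i; rewrite SE; exact: (weight_on_cvg n_gt0 stat c_gt0 coer xcvg).
- exists xs; split=> [|//|j|i|j]; rewrite ?rowE ?inS //; last by move/eqP.
  split=> [|z]; rewrite rows_of_mulmxE.
    by apply/rows_of_eqP => i; rewrite inS subr_eq0 => /eqP.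
  move=> /rows_of_eqP zb; apply/eqP; rewrite -subr_eq0; apply/eqP; apply: uniq => i iS.
  move: (iS); rewrite inS subr_eq0 => /eqP xsb.
  have -> : (A *m (xs - z)) i 0 = (A *m xs) i 0 - (A *m z) i 0.
    by rewrite mulmxBr !mxE.
  by rewrite xsb zb // subrr.
Unshelve. all: by end_near. Qed.
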